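(* Let $G$ be a connected $P_5$-free graph that admits a proper perfect edge dominating set $P$, with associated 3-colouring $(B,Y,W)$. Then $G$ has a dominating set $\{v_1,v_2,v_3\}$ inducing a path $v_1v_2v_3$ (edges $v_1v_2$, $v_2v_3$, and $v_1v_3\notin E(G)$) whose colours $(c(v_1),c(v_2),c(v_3))$ are one of: (a) $(B,B,Y)$ or $(Y,B,B)$; (b) $(B,Y,W)$ or $(W,Y,B)$; (c) $(Y,B,Y)$; (d) $(W,Y,W)$; (e) $(Y,W,Y)$.
   Context: Graphs are finite, simple and undirected; a graph is $P_5$-free if it has no induced path on 5 vertices. An edge dominates itself and every edge sharing an endpoint with it. A set $P\subseteq E(G)$ is a perfect edge dominating set if every edge of $E(G)\setminus P$ is dominated by exactly one edge of $P$, and an efficient edge dominating set if every edge of $E(G)$ is dominated by exactly one edge of $P$; $E(G)$ is the trivial one; $P$ is proper if it is neither trivial nor efficient. The 3-colouring $(B,Y,W)$ associated to $P$: $B$ = vertices incident to at least two edges of $P$, $Y$ = vertices incident to exactly one edge of $P$, $W$ = vertices incident to no edge of $P$; $c(v)$ denotes the class containing $v$. A set $X$ of vertices is dominating if every vertex outside $X$ has a neighbour in $X$. *)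

(* Defs.v *)
From mathcomp Require Import all_boot.
Set Implicit Arguments.
Unset Strict Implicit.
Unset Printing Implicit Defensive.

Definition simple_graph (T : finType) (e : rel T) : Prop :=
  symmetric e /\ irreflexive e.

Definition edges (T : finType) (e : rel T) : {set {set T}} :=
  [set [set p.1; p.2] | p : T * T & e p.1 p.2].

Definition connected_graph (T : finType) (e : rel T) : Prop :=
  forall x y : T, connect e x y.

Definition P5_free (T : finType) (e : rel T) : Prop :=
  ~ exists f : 'I_5 -> T, injective f /\
      forall i j : 'I_5, e (f i) (f j) = (i.+1 == j :> nat) || (j.+1 == i :> nat).

Definition edge_dominates (T : finType) (f g : {set T}) : bool :=
  (f == g) || (f :&: g != set0).

Definition dominators (T : finType) (P : {set {set T}}) (g : {set T}) :
    {set {set T}} :=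
  [set f in P | edge_dominates f g].

Definition perfect_eds (T : finType) (e : rel T) (P : {set {set T}}) : Prop :=
  P \subset edges e /\
  forall g, g \in edges e :\: P -> #|dominators P g| = 1.

Definition efficient_eds (T : finType) (e : rel T) (P : {set {set T}}) : Prop :=
  P \subset edges e /\
  forall g, g \in edges e -> #|dominators P g| = 1.

Definition proper_perfect_eds (T : finType) (e : rel T) (P : {set {set T}}) :
    Prop :=
  [/\ perfect_eds e P, P <> edges e & ~ efficient_eds e P].

Inductive colour : Set := cB | cY | cW.

Definition edge_colour (T : finType) (P : {set {set T}}) (v : T) : colour :=
  match #|[set f in P | v \in f]| with
  | 0 => cW
  | 1 => cY
  | _ => cB
  end.

Definition dominating_set (T : finType) (e : rel T) (X : {set T}) : Prop :=
  forall v, v \notin X -> exists2 u, u \in X & e v u.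

Definition induces_P3 (T : finType) (e : rel T) (v1 v2 v3 : T) : Prop :=
  [/\ uniq [:: v1; v2; v3], e v1 v2, e v2 v3 & ~~ e v1 v3].

(* Main.v *)
(** A perfect edge dominating set forces its colouring to be rigid: [W] is
    independent with all its neighbours in [Y], and every [Y]-vertex has exactly one
    neighbour outside [W].  Call a [Y]-vertex attached if that neighbour is in [B],
    detached if it is in [Y].  If [y] is attached to [b] and has a [W]-neighbour,
    [P5]-freeness makes the vertices reached from [b] through
    [B], attached, [W], detached closed under adjacency, so by connectedness [b] is
    adjacent to the rest of [B], every [W]-vertex sees an attached vertex, and every
    detached vertex sees a [W]-vertex.  Again by [P5]-freeness, the
    [W]-neighbourhoods of the attached vertices form a chain, and so do those of the
    detached ones.  Take [y] attached with the largest [W]-neighbourhood, which is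
    then all of [W], and [w] in the smallest [W]-neighbourhood of a detached vertex:
    [b y w] is a dominating path coloured [(B, Y, W)]. *)
Require Import Defs.
From mathcomp Require Import all_boot.

Set Implicit Arguments.
Unset Strict Implicit.
Unset Printing Implicit Defensive.

(** * Connectedness as an induction principle, and sets in a chain *)

Lemma connected_graph_ind (T : finType) (e : rel T) (S : T -> Prop) (x : T) :
  connected_graph e -> (forall u v, S u -> e u v -> S v) -> S x ->
  forall y, S y.
Proof.
move=> conn closedS Sx y; have /connectP[p pth ->] := conn x y.
elim: p x Sx pth => //= z p IHp x Sx /andP[exz pth].
by apply: IHp pth; apply: closedS exz.
Qed.

Lemma chain_sub_card (T : finType) (A B : {set T}) :
  A \subset B \/ B \subset A -> #|A| <= #|B| -> A \subset B.
Proof.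
by case=> // sBA leAB; have /eqP-> // : B == A by rewrite eqEcard sBA.
Qed.

(** * Induced paths on five vertices *)

Section P5Free.

Context (T : finType) (e : rel T).
Hypotheses (e_sym : symmetric e) (e_irr : irreflexive e) (GP5 : P5_free e).

(** Distinctness of the five vertices follows from the adjacencies: no two vertices of the path [P5]
    have the same neighbourhood, so [g] is injective. *)
Lemma P5_freeP (a b c d f : T) :
  e a b -> e b c -> e c d -> e d f ->
  ~~ e a c -> ~~ e a d -> ~~ e a f -> ~~ e b d -> ~~ e b f -> ~~ e c f -> False.
Proof.
move=> ab bc cd df /negbTE ac /negbTE ad /negbTE af /negbTE bd /negbTE bf /negbTE cf.
pose g (i : 'I_5) := nth a [:: a; b; c; d; f] i.
have gE (i j : 'I_5) :
    e (g i) (g j) = (i.+1 == j :> nat) || (j.+1 == i :> nat).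
  case: i j => [[|[|[|[|[|i]]]]] //= ?] [[|[|[|[|[|j]]]]] //= ?];
  by rewrite /g /= ?e_irr // ?ab ?bc ?cd ?df ?ac ?ad ?af ?bd ?bf ?cf //
     e_sym ?ab ?bc ?cd ?df ?ac ?ad ?af ?bd ?bf ?cf.
apply: GP5; exists g; split=> // i j gij; apply: val_inj.
have adj (k : 'I_5) : ((i.+1 == k :> nat) || (k.+1 == i :> nat))
    = ((j.+1 == k :> nat) || (k.+1 == j :> nat)) by rewrite -!gE gij.
move: (adj (inord 0)) (adj (inord 1)) (adj (inord 2)) (adj (inord 3)) (adj (inord 4)).
rewrite !inordK //; clear.
by case: i j => [[|[|[|[|[|i]]]]] //= ?] [[|[|[|[|[|j]]]]] //= ?].
Qed.

(** * Colourings subject to the two local rules on [W] and [Y] *)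

Section Colouring.

Context (c : T -> colour).
Hypotheses (conn : connected_graph e)
  (W_nbr : forall x y, c x = cW -> e x y -> c y = cY)
  (Y_partner : forall y u v, c y = cY -> e y u -> e y v ->
     c u <> cW -> c v <> cW -> u = v).

Definition is_B (v : T) : bool := if c v is cB then true else false.
Definition is_W (v : T) : bool := if c v is cW then true else false.
Definition Wnbrs (y : T) : {set T} := [set w | is_W w & e y w].
Definition attached (y : T) : bool :=
  if c y is cY then [exists b, is_B b && e y b] else false.
Definition detached (y : T) : bool :=
  if c y is cY then ~~ [exists b, is_B b && e y b] else false.

Lemma WnbrsP (y w : T) : reflect (c w = cW /\ e y w) (w \in Wnbrs y).
Proof.
rewrite inE /is_W; case: (c w); first by constructor; case.
  by constructor; case.
by apply: (iffP idP) => // -[].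
Qed.

Lemma attachedP (y : T) :
  reflect (c y = cY /\ exists2 b, c b = cB & e y b) (attached y).
Proof.
rewrite /attached; case: (c y); try by constructor; case.
apply: (iffP existsP) => [[b /andP[]]|[_ [b cb yb]]].
  by rewrite /is_B; case cb: (c b) => // _ yb; split=> //; exists b.
by exists b; rewrite /is_B cb.
Qed.

Lemma Y_attached_or_detached (y : T) : c y = cY -> attached y \/ detached y.
Proof.
by rewrite /attached /detached => ->; case: [exists b, _]; [left | right].
Qed.

Lemma detached_Y (y : T) : detached y -> c y = cY.
Proof. by rewrite /detached; case: (c y). Qed.

Lemma detached_not_attached (y : T) : detached y -> attached y = false.
Proof. by rewrite /detached /attached; case: (c y) => // /negbTE. Qed.

Lemma detached_nbr_B (y b : T) : detached y -> c b = cB -> ~~ e y b.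
Proof.
move=> dy cb; apply/negP => yb; have := detached_not_attached dy.
by move/attachedP; apply; split; [exact: detached_Y | exists b].
Qed.

Lemma B_nbr_W (b w : T) : c b = cB -> c w = cW -> ~~ e b w.
Proof.
by move=> cb cw; apply/negP; rewrite e_sym => wb; have := W_nbr cw wb; rewrite cb.
Qed.

Lemma W_independent (v w : T) : c v = cW -> c w = cW -> ~~ e v w.
Proof. by move=> cv cw; apply/negP => /(W_nbr cv); rewrite cw. Qed.

Lemma attached_nbr_Y (b y z : T) :
  c y = cY -> c b = cB -> e y b -> c z = cY -> ~~ e y z.
Proof.
move=> cy cb yb cz; apply/negP => yz.
have bz : b = z by apply: (Y_partner cy yb yz); rewrite ?cb ?cz.
by move: cb; rewrite bz cz.
Qed.

Lemma attached_nbr_B (b y x : T) :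
  c y = cY -> c b = cB -> e y b -> c x = cB -> x != b -> ~~ e y x.
Proof.
move=> cy cb yb cx /eqP xb; apply/negP => yx; apply: xb.
by apply: (Y_partner cy yx yb); rewrite ?cb ?cx.
Qed.

(* [b] has a pendant path [b y w] into [W], which any two further steps inside
   [B] would extend to an induced [P5]. *)
Lemma B_closed_nbrs (b y w x z : T) :
  c b = cB -> c y = cY -> c w = cW -> e y b -> e y w ->
  c x = cB -> c z = cB -> x = b \/ e b x -> e x z -> z = b \/ e b z.
Proof.
move=> cb cy cw yb yw cx cz [->|bx] xz; first by right.
have [->|zb] := eqVneq z b; first by left.
right; apply/negP => /negP bz.
have xb : x != b by apply: contraTneq bx => ->; rewrite e_irr.
apply: (@P5_freeP w y b x z) => //; rewrite 1?e_sym //.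
- exact: B_nbr_W.
- exact: B_nbr_W.
- exact: B_nbr_W.
- by rewrite e_sym; exact: (attached_nbr_B cy cb yb cx).
- by rewrite e_sym; exact: (attached_nbr_B cy cb yb cz).
Qed.

(** If [w] missed [q], then [b y w p q] would be an induced [P5]. *)
Lemma detached_twin (b y w p q : T) :
  c b = cB -> c y = cY -> c w = cW -> e y b -> e y w ->
  detached p -> detached q -> e w p -> e p q -> e w q.
Proof.
move=> cb cy cw yb yw dp dq wp pq; apply/negP => /negP wq.
have [cp cq] := (detached_Y dp, detached_Y dq).
apply: (@P5_freeP b y w p q) => //; rewrite 1?e_sym //.
- by rewrite e_sym; exact: B_nbr_W.
- exact: detached_nbr_B.
- exact: detached_nbr_B.
- by rewrite e_sym; exact: (attached_nbr_Y cy cb yb).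
- by rewrite e_sym; exact: (attached_nbr_Y cy cb yb).
Qed.

(** Otherwise [b y w y' b'] would be an induced [P5]. Crossing [w] thus leads back to [b] or to a
    neighbour of it. *)
Lemma attached_W_partner (b y w y' b' : T) :
  c b = cB -> c y = cY -> c w = cW -> e y b -> e y w ->
  c y' = cY -> c b' = cB -> e w y' -> e y' b' -> b' = b \/ e b b'.
Proof.
move=> cb cy cw yb yw cy' cb' wy' yb'.
have [->|bb'] := eqVneq b' b; first by left.
right; apply/negP => /negP nbb'.
apply: (@P5_freeP b y w y' b') => //; rewrite 1?e_sym //.
- by rewrite e_sym; exact: B_nbr_W.
- by apply: (attached_nbr_B cy' cb'); rewrite 1?eq_sym.
- by rewrite e_sym; exact: (attached_nbr_Y cy cb yb).
- by rewrite e_sym; exact: (attached_nbr_B cy cb yb cb').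
- exact: B_nbr_W.
Qed.

(** Otherwise [b y w p w'] would be an induced [P5]. A step back from [p] into [W] thus stays among
    the neighbours of [y]. *)
Lemma detached_W_nbr (b y w p w' : T) :
  c b = cB -> c y = cY -> c w = cW -> e y b -> e y w ->
  detached p -> e w p -> c w' = cW -> e p w' -> e y w'.
Proof.
move=> cb cy cw yb yw dp wp cw' pw'; apply/negP => /negP yw'.
have cp := detached_Y dp.
apply: (@P5_freeP b y w p w') => //; rewrite 1?e_sym //.
- by rewrite e_sym; exact: B_nbr_W.
- exact: detached_nbr_B.
- by rewrite e_sym; exact: B_nbr_W.
- by rewrite e_sym; exact: (attached_nbr_Y cy cb yb).
- exact: W_independent.
Qed.

(** * Reachability from one pendant path *)

Lemma layers (b0 y0 w0 : T) :
  c b0 = cB -> c y0 = cY -> c w0 = cW -> e y0 b0 -> e y0 w0 ->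
  forall v, match c v with
    | cB => v = b0 \/ e b0 v
    | cY => attached v \/
            exists w y, [/\ c w = cW, e w v, attached y & e y w]
    | cW => exists2 y, attached y & e y v
    end.
Proof.
move=> cb0 cy0 cw0 yb0 yw0.
(* Each predicate records a route back to the layer of [B], which supplies the initial vertices
   [b y w] of the forbidden paths. *)
pose nearB b := c b = cB /\ (b = b0 \/ e b0 b).
pose nearY y := c y = cY /\ exists2 b, nearB b & e y b.
pose nearW w := c w = cW /\ exists2 y, nearY y & e y w.
pose farY p := detached p /\ exists2 w, nearW w & e w p.
pose near v := [\/ nearB v, nearY v, nearW v | farY v].
have nearB_step x z : nearB x -> e x z -> c z = cB -> nearB z.
  move=> [cx bx] xz cz; split=> //.
  exact: (B_closed_nbrs cb0 cy0 cw0 yb0 yw0 cx cz bx xz).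
have nearY_att y : nearY y -> attached y.
  by move=> [cy [b [cb _] yb]]; apply/attachedP; split=> //; exists b.
suff nearT : forall v, near v.
  move=> v; case: (nearT v) => [[-> //]|nY|[cv [y nY yv]]|[dv [w [cw [y nY yw]] wv]]].
  - by rewrite nY.1; left; exact: nearY_att.
  - by rewrite cv; exists y => //; exact: nearY_att.
  - rewrite detached_Y //; right; exists w, y; split=> //; exact: nearY_att.
apply: (connected_graph_ind (S := near) (x := b0)) conn _ _; last first.
  by constructor 1; split=> //; left.
move=> u v [nu|nu|nu|nu] uv.
- case cv: (c v).
  + by constructor 1; exact: nearB_step uv cv.
  + by constructor 2; split=> //; exists u; rewrite 1?e_sym.
  + by have := B_nbr_W nu.1 cv; rewrite uv.
- case: (nu) => cu [b nb ub].
  case cv: (c v); last by constructor 3; split=> //; exists u.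
  + suff -> : v = b by constructor 1.
    by apply: (Y_partner cu uv ub); rewrite ?cv ?nb.1.
  + by have := attached_nbr_Y cu nb.1 ub cv; rewrite uv.
- case: (nu) => cu [y [cy [b nb yb]] yu].
  have cv := W_nbr cu uv.
  case: (Y_attached_or_detached cv) => [/attachedP[_ [b' cb' vb']]|dv]; last first.
    by constructor 4; split=> //; exists u.
  constructor 2; split=> //; exists b' => //.
  case: (attached_W_partner nb.1 cy cu yb yu cv cb' uv vb') => [-> //|bb'].
  exact: nearB_step bb' cb'.
- case: nu => du [w nW wu]; case: (nW) => cw [y nY yw]; case: (nY) => cy [b nb yb].
  case cv: (c v).
  + by have := detached_nbr_B du cv; rewrite uv.
  + have dv : detached v.
      case: (Y_attached_or_detached cv) => // /attachedP[_ [b' cb' vb']].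
      by have := attached_nbr_Y cv cb' vb' (detached_Y du); rewrite e_sym uv.
    constructor 4; split=> //; exists w => //.
    exact: (detached_twin nb.1 cy cw yb yw du dv wu uv).
  + constructor 3; split=> //; exists y => //.
    exact: (detached_W_nbr nb.1 cy cw yb yw du wu cv uv).
Qed.

(** Supplies the starting path of [layers]. If no attached vertex had a [W]-neighbour, [B] together
    with the attached vertices would be closed under adjacency and [w] could not be reached from
    [b]. *)
Lemma attached_W_exists (b w : T) :
  c b = cB -> c w = cW ->
  exists b0 y0 w0, [/\ c b0 = cB, c y0 = cY, c w0 = cW, e y0 b0 & e y0 w0].
Proof.
move=> cb cw.
have [/existsP[y /andP[/attachedP[cy [b0 cb0 yb0]] /set0Pn[w0]]]|none] :=
  boolP [exists y, attached y && (Wnbrs y != set0)].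
  by case/WnbrsP=> cw0 yw0; exists b0, y, w0.
have := connected_graph_ind (S := fun v => c v = cB \/ attached v)
  conn _ (or_introl cb) w.
case=> [u v S_u uv| |].
- case cv: (c v); first by left.
    right; case: S_u => [cu|/attachedP[cu [x cx ux]]].
      by apply/attachedP; split=> //; exists u; rewrite 1?e_sym.
    by have := attached_nbr_Y cu cx ux cv; rewrite uv.
  case: S_u => [cu|au]; first by have := B_nbr_W cu cv; rewrite uv.
  case/existsP: none; exists u; rewrite au; apply/set0Pn; exists v.
  exact/WnbrsP.
- by rewrite cw.
- by case/attachedP; rewrite cw.
Qed.

(** * Nested [W]-neighbourhoods and the dominating path *)

(** Suppose [w1] and [w2] are private neighbours of [y1] and [y2]. With a common partner,
    [w1 y1 b1 y2 w2] is an induced [P5]; with distinct partners, [layers] makes [b1] and [b2]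
    adjacent and [w1 y1 b1 b2 y2] is one. *)
Lemma attached_chain (y1 y2 : T) :
  attached y1 -> attached y2 ->
  Wnbrs y1 \subset Wnbrs y2 \/ Wnbrs y2 \subset Wnbrs y1.
Proof.
move=> /attachedP[cy1 [b1 cb1 yb1]] /attachedP[cy2 [b2 cb2 yb2]].
have [|/subsetPn[w1 /WnbrsP[cw1 yw1] w1N]] := boolP (_ \subset _); first by left.
have [|/subsetPn[w2 /WnbrsP[cw2 yw2] w2N]] := boolP (Wnbrs y2 \subset _); first by right.
have {}w1N : ~~ e y2 w1 by apply: contra w1N => ?; apply/WnbrsP.
have {}w2N : ~~ e y1 w2 by apply: contra w2N => ?; apply/WnbrsP.
exfalso; have [b12|b12] := eqVneq b1 b2.
  rewrite -{}b12 in cb2 yb2.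
  apply: (@P5_freeP w1 y1 b1 y2 w2) => //; rewrite 1?e_sym //.
  - exact: B_nbr_W.
  - exact: W_independent.
  - by rewrite e_sym; exact: (attached_nbr_Y cy1 cb1 yb1).
  - by rewrite e_sym; exact: B_nbr_W.
have := layers cb1 cy1 cw1 yb1 yw1 b2; rewrite cb2 => -[b21|eb12].
  by rewrite b21 eqxx in b12.
apply: (@P5_freeP w1 y1 b1 b2 y2) => //; rewrite 1?e_sym //.
- exact: B_nbr_W.
- exact: B_nbr_W.
- by rewrite e_sym; apply: (attached_nbr_B cy1 cb1) => //; rewrite eq_sym.
- by rewrite e_sym; exact: (attached_nbr_Y cy1 cb1 yb1).
- exact: (attached_nbr_B cy2 cb2).
Qed.

(** Private neighbours [w1] of [p] and [w2] of [q] are joined through [y], giving the induced path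
    [p w1 y w2 q]; an edge [p q] is excluded by [detached_twin]. *)
Lemma detached_chain (b y p q : T) :
  c b = cB -> c y = cY -> e y b -> (forall w, c w = cW -> e y w) ->
  detached p -> detached q ->
  Wnbrs p \subset Wnbrs q \/ Wnbrs q \subset Wnbrs p.
Proof.
move=> cb cy yb yW dp dq.
have [|/subsetPn[w1 /WnbrsP[cw1 pw1] w1N]] := boolP (_ \subset _); first by left.
have [|/subsetPn[w2 /WnbrsP[cw2 qw2] w2N]] := boolP (Wnbrs q \subset _); first by right.
have {}w1N : ~~ e q w1 by apply: contra w1N => ?; apply/WnbrsP.
have {}w2N : ~~ e p w2 by apply: contra w2N => ?; apply/WnbrsP.
exfalso; have [cp cq] := (detached_Y dp, detached_Y dq).
have pq : ~~ e p q.
  apply: contra w1N => pq; rewrite e_sym.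
  by apply: (detached_twin cb cy cw1 yb (yW _ cw1) dp dq) pq; rewrite e_sym.
apply: (@P5_freeP p w1 y w2 q) => //.
- by rewrite e_sym; exact: yW.
- exact: yW.
- by rewrite e_sym.
- by rewrite e_sym; exact: (attached_nbr_Y cy cb yb).
- exact: W_independent.
- by rewrite e_sym.
- exact: (attached_nbr_Y cy cb yb).
Qed.

Lemma dominating_BYW (b1 w1 : T) :
  c b1 = cB -> c w1 = cW ->
  exists b y w, [/\ c b = cB, c y = cY, c w = cW, e b y & e y w] /\
    dominating_set e [set b; y; w].
Proof.
move=> cb1 cw1.
have [b0 [y0 [w0 [cb0 cy0 cw0 yb0 yw0]]]] := attached_W_exists cb1 cw1.
have ay0 : attached y0 by apply/attachedP; split=> //; exists b0.
have [y ay ymax] := @arg_maxnP _ y0 attached (fun y => #|Wnbrs y|) ay0.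
have [cy [b cb yb]] := attachedP _ ay.
have yW w : c w = cW -> e y w.
  move=> cw; have := layers cb0 cy0 cw0 yb0 yw0 w; rewrite cw => -[z az zw].
  have sub : Wnbrs z \subset Wnbrs y.
    by apply: chain_sub_card (ymax z az); exact: attached_chain.
  by have /WnbrsP[] : w \in Wnbrs y by apply: (subsetP sub); apply/WnbrsP.
have [w cw wD] : exists2 w, c w = cW & forall p, detached p -> e p w.
  have [/existsP[p dp]|/existsPn nod] := boolP [exists p, detached p]; last first.
    (* With no detached vertex to dominate, any [W]-vertex serves. *)
    by exists w1 => // p dp; have := nod p; rewrite dp.
  have [q dq qmin] := @arg_minnP _ p detached (fun y => #|Wnbrs y|) dp.
  have := layers cb0 cy0 cw0 yb0 yw0 q; rewrite (detached_Y dq).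
  rewrite (detached_not_attached dq) => -[//|[w [_ [cw wq _ _]]]].
  exists w => // r dr.
  have /subsetP sub : Wnbrs q \subset Wnbrs r.
    apply: chain_sub_card (qmin r dr).
    exact: (detached_chain cb cy yb yW).
  by have /sub/WnbrsP[] : w \in Wnbrs q; first by apply/WnbrsP; rewrite e_sym.
have yw := yW w cw.
exists b, y, w; split; first by split; rewrite // e_sym.
move=> v; rewrite !inE !negb_or => /andP[/andP[vb vy] vw].
have bX : b \in [set b; y; w] by rewrite !inE eqxx.
have yX : y \in [set b; y; w] by rewrite !inE eqxx orbT.
have wX : w \in [set b; y; w] by rewrite !inE eqxx orbT.
case cv: (c v).
(* [layers] is applied afresh to the chosen path, since [b] may differ from [b0]. *)
- exists b => //; have := layers cb cy cw yb yw v; rewrite cv e_sym.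
  by case=> // vb'; rewrite vb' eqxx in vb.
- case: (Y_attached_or_detached cv) => [/attachedP[_ [x cx vx]]|dv]; last first.
    by exists w => //; exact: wD.
  have := layers cb cy cw yb yw x; rewrite cx => -[xb|bx].
    by exists b; rewrite -?xb // xb.
  (* An attached [v] whose partner [x] is not [b] must see [w], or else [w y b x v] is an induced
     [P5]. *)
  exists w => //; apply/negP => /negP vNw.
  have xb : x != b by apply: contraTneq bx => ->; rewrite e_irr.
  apply: (@P5_freeP w y b x v) => //; rewrite 1?e_sym //.
  + exact: B_nbr_W.
  + exact: B_nbr_W.
  + by rewrite e_sym; exact: (attached_nbr_B cy cb yb cx).
  + by rewrite e_sym; exact: (attached_nbr_Y cy cb yb).
  + by apply: (attached_nbr_B cv cx) => //; rewrite eq_sym.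
- by exists y => //; rewrite e_sym; exact: yW.
Qed.

End Colouring.
End P5Free.

(** * The colouring of a perfect edge dominating set obeys the local rules *)

Section PerfectEdgeDomination.

Context (T : finType) (e : rel T) (P : {set {set T}}).
Hypotheses (e_irr : irreflexive e) (PP : perfect_eds e P).

Let D (v : T) : {set {set T}} := [set f in P | v \in f].
Let c := edge_colour P.

Lemma edgesP (g : {set T}) :
  reflect (exists x y, e x y /\ g = [set x; y]) (g \in edges e).
Proof.
apply: (iffP imsetP) => [[[x y]]|[x [y [exy ->]]]].
  by rewrite inE /= => exy ->; exists x, y.
by exists (x, y); rewrite ?inE.
Qed.

Lemma edge_mem (x y : T) : e x y -> [set x; y] \in edges e.
Proof. by move=> exy; apply/edgesP; exists x, y. Qed.

Lemma edge_neq (x y : T) : e x y -> x != y.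
Proof. by apply: contraTneq => ->; rewrite e_irr. Qed.

Lemma edge_eq_set2 (x y : T) (f : {set T}) :
  f \in edges e -> x != y -> x \in f -> y \in f -> f = [set x; y].
Proof.
move=> /edgesP[a [b [_ ->]]] xy; rewrite !inE.
case/orP=> /eqP xE /orP[] /eqP yE; rewrite -?xE -?yE //.
- by rewrite xE yE eqxx in xy.
- by rewrite setUC.
- by rewrite xE yE eqxx in xy.
Qed.

(** Reduces domination to incidence, the notion from which colours are defined. *)
Lemma dominators_set2 (x y : T) : dominators P [set x; y] = D x :|: D y.
Proof.
apply/setP => f; rewrite !inE -andb_orr /edge_dominates; congr (_ && _).
apply/idP/idP => [/orP[/eqP->|/set0Pn[z]]|].
- by rewrite !inE eqxx.
- by rewrite !inE => /andP[zf /orP[]/eqP <-]; rewrite zf ?orbT.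
- by case/orP=> zf; apply/orP; right; apply/set0Pn;
    [exists x | exists y]; rewrite !inE zf eqxx ?orbT.
Qed.

Lemma card_dominators_nonP (x y : T) :
  e x y -> [set x; y] \notin P -> #|D x :|: D y| = 1.
Proof.
by move=> exy nP; rewrite -dominators_set2; apply: PP.2; rewrite inE nP edge_mem.
Qed.

Lemma colour_W (v : T) : c v = cW <-> D v = set0.
Proof.
rewrite /c /edge_colour -/(D v); split=> [|->]; last by rewrite cards0.
by case E: #|D v| => [|[|n]] // _; apply/eqP; rewrite -cards_eq0 E.
Qed.

Lemma colour_Y (v : T) : c v = cY <-> #|D v| = 1.
Proof. by rewrite /c /edge_colour -/(D v); case: #|D v| => [|[|n]]. Qed.

Lemma W_edge_nonP (x y : T) : c x = cW -> [set x; y] \notin P.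
Proof.
by move/colour_W/setP/(_ [set x; y]); rewrite !inE eqxx andbT => ->.
Qed.

(** Were the edge outside [P], its single dominator would contain both [x] and [y], hence be the
    edge itself. *)
Lemma nonW_edge_P (x y : T) :
  e x y -> c x <> cW -> c y <> cW -> [set x; y] \in P.
Proof.
move=> exy cx cy; apply/negPn/negP => nP.
have /eqP/cards1P[f Df] := card_dominators_nonP exy nP.
have fD v : c v <> cW -> D v \subset [set f] -> f \in D v.
  move=> cv; rewrite subset1 => /orP[/eqP->|/eqP D0]; first exact: set11.
  by case: cv; apply/colour_W.
have := fD x cx; rewrite -Df subsetUl inE => /(_ isT)/andP[fP xf].
have := fD y cy; rewrite -Df subsetUr inE => /(_ isT)/andP[_ yf].
have fe := subsetP PP.1 f fP.
by rewrite -(edge_eq_set2 fe (edge_neq exy) xf yf) fP in nP.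
Qed.

Lemma perfect_W_nbr (x y : T) : c x = cW -> e x y -> c y = cY.
Proof.
move=> cx exy; apply/colour_Y.
have := card_dominators_nonP exy (W_edge_nonP y cx).
by have /colour_W-> := cx; rewrite set0U.
Qed.

(** Both edges lie in [P] by [nonW_edge_P], and only one edge of [P] meets [y]. *)
Lemma perfect_Y_partner (y u v : T) :
  c y = cY -> e y u -> e y v -> c u <> cW -> c v <> cW -> u = v.
Proof.
move=> cy yu yv cu cv; have cyW : c y <> cW by rewrite cy.
have /eqP/cards1P[f Df] := (colour_Y y).1 cy.
have inD z : e y z -> c z <> cW -> [set y; z] = f.
  move=> yz cz; apply/set1P; rewrite -Df inE nonW_edge_P //=.
  by rewrite !inE eqxx.
have : u \in [set y; v] by rewrite (inD v) // -(inD u) // !inE eqxx orbT.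
by rewrite !inE eq_sym (negbTE (edge_neq yu)) => /eqP.
Qed.

Lemma nontrivial_W : P <> edges e -> exists w, c w = cW.
Proof.
move=> PE; have : ~~ (edges e \subset P).
  by apply/negP => sEP; apply: PE; apply/eqP; rewrite eqEsubset PP.1.
case/subsetPn=> g /edgesP[x [y [exy ->]]] nP.
case cx: (c x); last by exists x.
all: case cy: (c y); last by exists y.
all: by rewrite nonW_edge_P ?cx ?cy in nP.
Qed.

Lemma nonefficient_B : ~ efficient_eds e P -> exists b, c b = cB.
Proof.
move=> nE; have [/existsP[b]|/existsPn noB] := boolP [exists b, 1 < #|D b|].
  move=> Db; exists b; rewrite /c /edge_colour -/(D b).
  by case: #|D b| Db => [|[|n]].
case: nE; split; first exact: PP.1.
move=> g ge; have [gP|nP] := boolP (g \in P); last by apply: PP.2; rewrite inE nP.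
case/edgesP: ge gP => x [y [_ ->]] gP; rewrite dominators_set2.
(* Without [B]-vertices, an edge of [P] is the only one at each of its ends, so it is dominated by
   itself alone. *)
have DE v : v \in [set x; y] -> D v = [set [set x; y]].
  move=> vg; apply/eqP; rewrite eq_sym eqEcard sub1set inE gP vg cards1.
  by rewrite leqNgt noB.
by rewrite !DE ?setUid ?cards1 // !inE eqxx ?orbT.
Qed.

End PerfectEdgeDomination.

Theorem theorem23 (T : finType) (e : rel T) (P : {set {set T}})
    (Ge : simple_graph e) (Gconn : connected_graph e) (GP5 : P5_free e)
    (PP : proper_perfect_eds e P) :
  exists v1 v2 v3 : T,
    dominating_set e [set v1; v2; v3] /\
    induces_P3 e v1 v2 v3 /\
    let c := edge_colour P in
    let cs := (c v1, c v2, c v3) in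
    (cs = (cB, cB, cY) \/ cs = (cY, cB, cB)) \/
    (cs = (cB, cY, cW) \/ cs = (cW, cY, cB)) \/
    cs = (cY, cB, cY) \/
    cs = (cW, cY, cW) \/
    cs = (cY, cW, cY).
Proof.
case: Ge PP => e_sym e_irr [PE nontriv noneff].
have [b1 cb1] := nonefficient_B PE noneff.
have [w1 cw1] := nontrivial_W e_irr PE nontriv.
have W_nbr := perfect_W_nbr PE.
have [b [y [w [[cb cy cw by_ yw] dom]]]] :=
  dominating_BYW e_sym e_irr GP5 Gconn W_nbr (perfect_Y_partner e_irr PE) cb1 cw1.
(* The colours always realise the first form of alternative (b). *)
exists b, y, w; split=> //; split; last by right; left; left; rewrite /= cb cy cw.
have bw := B_nbr_W e_sym W_nbr cb cw.
split=> //; rewrite /= !inE negb_or (edge_neq e_irr by_) (edge_neq e_irr yw) !andbT.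
by apply/eqP => bw_eq; move: cb; rewrite bw_eq cw.
Qed.
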